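(* Let $p\in(1,\infty)$, $p\neq2$, and let $\eta:\ell^3_{2,p}\to\ell^3_{2,p}$ be an affine map. Then $\eta\in\mathcal{T}(\ell^3_{2,p})$ if and only if there exist $\lambda\in\mathbb{R}$ and $c\in\mathbb{R}^3$ with $\eta(x_1,x_2,x_3)=\lambda(-x_2,x_1,0)+c$ for all $(x_1,x_2,x_3)\in\mathbb{R}^3$. In particular $\dim\mathcal{T}(\ell^3_{2,p})=4$.
   Context: $\ell^3_{2,p}$ denotes $\mathbb{R}^3$ with the norm $\|(x,y,z)\|_{2,p}=((x^2+y^2)^{p/2}+|z|^p)^{1/p}$. For a finite dimensional real normed space $X$, a rigid motion is a family $\{\alpha_x:[-1,1]\to X\}_{x\in X}$ of continuous paths with $\alpha_x(0)=x$ and $\|\alpha_x(t)-\alpha_y(t)\|=\|x-y\|$ for all $x,y\in X$, $t\in[-1,1]$. If each $\alpha_x$ is differentiable at $t=0$, the map $\eta(x)=\alpha_x'(0)$ is called an infinitesimal rigid motion of $X$; $\mathcal{T}(X)$ denotes the real vector space of all infinitesimal rigid motions of $X$. *)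

(* Defs.v *)
From HB Require Import structures.
From mathcomp Require Import all_boot all_order all_algebra.
From mathcomp Require Import all_classical all_reals all_analysis.
From mathcomp Require Import ring.
Set Implicit Arguments.
Unset Strict Implicit.
Unset Printing Implicit Defensive.
Import Order.TTheory GRing.Theory Num.Theory.
Import numFieldNormedType.Exports.
Local Open Scope classical_set_scope.
Local Open Scope ring_scope.

(* Only the values of [alpha x] on [-1, 1] matter: the paths are functions on
   all of R, but nothing is required of them outside of [-1, 1]. *)
Definition rigid_motion (R : realType) (X : normedModType R)
    (alpha : X -> R -> X) : Prop :=
  [/\ forall x, {within `[-1, 1], continuous (alpha x)},
      forall x, alpha x 0 = x &
      forall x y t, t \in `[-1, 1] -> `|alpha x t - alpha y t| = `|x - y|].

Definition inf_rigid_motions (R : realType) (X : normedModType R) :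
    set (X -> X) :=
  [set eta | exists2 alpha : X -> R -> X, rigid_motion alpha &
     forall x, derivable (alpha x) 0 1 /\ eta x = derive1 (alpha x) 0].
Arguments inf_rigid_motions {R} X.

Definition affine_map (R : pzRingType) (X Y : lmodType R) (f : X -> Y) : Prop :=
  exists (g : {linear X -> Y}) (c : Y), forall x, f x = g x + c.

(* [T] is a linear subspace of [V] with a basis of [n] vectors. The ambient
   space [V] may be infinite dimensional (e.g. a space of functions), so
   [{vspace V}] and [\dim] are not available. *)
Definition has_dim (R : pzRingType) (V : lmodType R) (T : set V) (n : nat) :
    Prop :=
  exists e : 'I_n -> V,
    (forall a : 'I_n -> R, \sum_(i < n) a i *: e i = 0 -> forall i, a i = 0) /\
    T = [set v | exists a : 'I_n -> R, v = \sum_(i < n) a i *: e i].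

Definition norm2p (R : realType) (p : R) (v : 'rV[R]_3) : R :=
  ((v 0 0 ^+ 2 + v 0 1 ^+ 2) `^ (p / 2) + `|v 0 2| `^ p) `^ p^-1.

Section norm2p_theory.
Context {R : realType} (p : R) (p_gt1 : 1 < p).
Implicit Types (a b c d : R) (u v : 'rV[R]_3).

Let p_gt0 : 0 < p. Proof. exact: lt_trans p_gt1. Qed.

Let p_neq0 : p != 0. Proof. by rewrite gt_eqF. Qed.

Let minkowski2 a b c d : 0 <= a -> 0 <= b -> 0 <= c -> 0 <= d ->
  ((a + c) `^ p + (b + d) `^ p) `^ p^-1 <=
  (a `^ p + b `^ p) `^ p^-1 + (c `^ p + d `^ p) `^ p^-1.
Proof.
move=> a0 b0 c0 d0.
set S := (a + c) `^ p + (b + d) `^ p.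
have S0 : 0 <= S by rewrite addr_ge0 ?powR_ge0.
have [->|Sneq0] := eqVneq S 0.
  by rewrite powR0 ?invr_eq0// addr_ge0 ?powR_ge0.
have Sgt0 : 0 < S by rewrite lt0r Sneq0.
pose q := p / (p - 1).
have p10 : 0 < p - 1 by rewrite subr_gt0.
have q0 : 0 < q by rewrite divr_gt0.
have pq : p^-1 + q^-1 = 1.
  by rewrite /q; field; rewrite p_neq0 gt_eqF.
have pqE : (p - 1) * q = p by rewrite /q; field; rewrite gt_eqF.
have powS x : 0 <= x -> x `^ p = x * x `^ (p - 1).
  move=> x0; have [->|xn0] := eqVneq x 0.
    by rewrite powR0 ?mul0r.
  by rewrite -{2}(powRr1 x0) -powRD ?xn0 ?implybT// addrC subrK.
have H x y : 0 <= x -> 0 <= y ->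
    x * (a + c) `^ (p - 1) + y * (b + d) `^ (p - 1) <=
    (x `^ p + y `^ p) `^ p^-1 * S `^ q^-1.
  move=> x0 y0.
  have := @hoelder2 R x y ((a + c) `^ (p - 1)) ((b + d) `^ (p - 1)) p q
    x0 y0 (powR_ge0 _ _) (powR_ge0 _ _) p_gt0 q0 pq.
  by rewrite -!powRrM pqE.
have SE : S = S `^ p^-1 * S `^ q^-1.
  by rewrite -powRD ?Sneq0 ?implybT// pq powRr1.
rewrite -(ler_pM2r (_ : 0 < S `^ q^-1)) ?powR_gt0// -SE mulrDl.
apply: le_trans (lerD (H _ _ a0 b0) (H _ _ c0 d0)).
rewrite /S (powS (a + c)) ?(powS (b + d)) ?addr_ge0//.
by rewrite le_eqVlt; apply/orP; left; apply/eqP; ring.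
Qed.

Let minkowskiE a b c d :
  Num.sqrt ((a + c) ^+ 2 + (b + d) ^+ 2) <=
  Num.sqrt (a ^+ 2 + b ^+ 2) + Num.sqrt (c ^+ 2 + d ^+ 2).
Proof.
set x := a ^+ 2 + b ^+ 2; set y := c ^+ 2 + d ^+ 2.
have x0 : 0 <= x by rewrite addr_ge0 ?sqr_ge0.
have y0 : 0 <= y by rewrite addr_ge0 ?sqr_ge0.
have cs : a * c + b * d <= Num.sqrt x * Num.sqrt y.
  rewrite (le_trans (ler_norm _))// -sqrtrM// -sqrtr_sqr ler_wsqrtr//.
  rewrite -subr_ge0.
  by rewrite (_ : _ - _ = (a * d - b * c) ^+ 2) ?sqr_ge0//; rewrite /x /y; ring.
rewrite -(@ger0_norm _ (Num.sqrt x + Num.sqrt y)) ?addr_ge0 ?sqrtr_ge0//.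
rewrite -sqrtr_sqr ler_wsqrtr// (sqrrD (Num.sqrt x)) !sqr_sqrtr//.
have -> : (a + c) ^+ 2 + (b + d) ^+ 2 = x + (a * c + b * d) *+ 2 + y.
  by rewrite /x /y; ring.
by rewrite lerD2r lerD2l lerMn2r cs orbT.
Qed.

Let powR_half_sqrt a : 0 <= a -> a `^ (p / 2) = Num.sqrt a `^ p.
Proof. by move=> a0; rewrite -powR12_sqrt// -powRrM [p / 2]mulrC. Qed.

Let norm2pE v : norm2p p v =
  (Num.sqrt (v 0 0 ^+ 2 + v 0 1 ^+ 2) `^ p + `|v 0 2| `^ p) `^ p^-1.
Proof. by rewrite /norm2p powR_half_sqrt// addr_ge0 ?sqr_ge0. Qed.

Let ler_norm2pD_coord a1 a2 a3 b1 b2 b3 :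
  (Num.sqrt ((a1 + b1) ^+ 2 + (a2 + b2) ^+ 2) `^ p + `|a3 + b3| `^ p) `^ p^-1 <=
  (Num.sqrt (a1 ^+ 2 + a2 ^+ 2) `^ p + `|a3| `^ p) `^ p^-1 +
  (Num.sqrt (b1 ^+ 2 + b2 ^+ 2) `^ p + `|b3| `^ p) `^ p^-1.
Proof.
have p_ge0 := ltW p_gt0.
apply: le_trans (minkowski2 (sqrtr_ge0 _) (normr_ge0 _) (sqrtr_ge0 _)
  (normr_ge0 _)).
rewrite ge0_ler_powR ?invr_ge0// ?nnegrE ?addr_ge0 ?powR_ge0//.
by rewrite lerD// ge0_ler_powR// ?nnegrE ?addr_ge0 ?sqrtr_ge0// ler_normD.
Qed.

Lemma ler_norm2pD u v : norm2p p (u + v) <= norm2p p u + norm2p p v.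
Proof. by rewrite !norm2pE !mxE; exact: ler_norm2pD_coord. Qed.

Lemma norm2pZ a v : norm2p p (a *: v) = `|a| * norm2p p v.
Proof.
rewrite !norm2pE !mxE !exprMn -mulrDr sqrtrM ?sqr_ge0// sqrtr_sqr normrM.
rewrite !powRM ?sqrtr_ge0// -mulrDr powRM ?addr_ge0 ?powR_ge0//.
by rewrite -powRrM mulfV// powRr1.
Qed.

Lemma norm2p_eq0 v : norm2p p v = 0 -> v = 0.
Proof.
rewrite norm2pE => /powR_eq0_eq0/eqP.
rewrite paddr_eq0 ?powR_ge0// => /andP[/eqP/powR_eq0_eq0/eqP + /eqP/powR_eq0_eq0].
rewrite sqrtr_eq0 => h /eqP; rewrite normr_eq0 => /eqP v2.
have : v 0 0 ^+ 2 + v 0 1 ^+ 2 == 0 by rewrite eq_le h addr_ge0 ?sqr_ge0.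
rewrite paddr_eq0 ?sqr_ge0// !sqrf_eq0 => /andP[/eqP v0 /eqP v1].
apply/rowP => -[[|[|[|//]]] i]; rewrite mxE.
- by rewrite -[RHS]v0; congr (v 0 _); exact: val_inj.
- by rewrite -[RHS]v1; congr (v 0 _); exact: val_inj.
- by rewrite -[RHS]v2; congr (v 0 _); exact: val_inj.
Qed.

End norm2p_theory.

(* A copy of R^3 which carries the norm [norm2p p] and its topology instead of
   the sup norm that ['rV[R]_3] has in the library. The proof that [1 < p] is an
   argument of the type because the norm axioms depend on it. *)
Definition ell3_2p (R : realType) (p : R) (p_gt1 : 1 < p) : Type := 'rV[R]_3.

HB.instance Definition _ (R : realType) (p : R) (p_gt1 : 1 < p) :=
  GRing.Lmodule.copy (ell3_2p p_gt1) 'rV[R]_3.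

HB.instance Definition _ (R : realType) (p : R) (p_gt1 : 1 < p) :=
  Lmodule_isNormed.Build R (ell3_2p p_gt1)
    (ler_norm2pD p_gt1) (norm2pZ p_gt1) (@norm2p_eq0 R p).

Definition vec3 (R : realType) (p : R) (p_gt1 : 1 < p) (x1 x2 x3 : R) :
    ell3_2p p_gt1 :=
  \row_(i < 3) [:: x1; x2; x3]`_i.

(* Main.v *)
(** Any isometry of a strictly convex space is affine, so an infinitesimal rigid
motion [eta], being a pointwise limit of difference quotients of isometries, is
affine. Strict convexity comes from the strict tangent inequality
[Phi v + p * D v (u - v) <= Phi u] for [Phi v = `|v| ^ p], where [p * D v] is
the differential of [Phi]. The same inequality shows that along a rigid motion
[D (x - y) (alpha x t - alpha y t)] is maximal at [t = 0], so that
[D (x - y) (eta x - eta y) = 0] and the linear part [A] of [eta] satisfies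
[D v (A v) = 0] for all [v]. Evaluating at [(1, 0, s)] and [(0, 1, s)] for
[s = 1] and [s = 2] kills the entries that mix the plane with the axis, because
[s = s ^ (p - 1)] fails at [s = 2] unless [p = 2]. *)
Require Import Defs.
From mathcomp Require Import all_boot all_order all_algebra.
From mathcomp Require Import all_classical all_reals all_analysis.
From mathcomp Require Import ring lra.
Set Implicit Arguments.
Unset Strict Implicit.
Unset Printing Implicit Defensive.
Import Order.TTheory GRing.Theory Num.Theory.
Import numFieldNormedType.Exports.
Local Open Scope classical_set_scope.
Local Open Scope ring_scope.

(** * Strict tangent inequality for powers of a nonnegative real *)

Lemma powR_tangent (R : realType) (p x y : R) : 1 < p -> 0 <= x -> 0 <= y ->
  y `^ p + p * y `^ (p - 1) * (x - y) <= x `^ p ?= iff (x == y).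
Proof.
move=> p1 x0 y0; have p0 : 0 < p by lra.
have p10 : p - 1 != 0 by lra.
have [->|xy] := eqVneq x y; first by split; rewrite subrr mulr0 addr0 ?eqxx.
suff lt : y `^ p + p * y `^ (p - 1) * (x - y) < x `^ p.
  by split; [exact: ltW | rewrite lt_eqF].
have [y_eq0|yn0] := eqVneq y 0.
  rewrite y_eq0 !powR0 ?(gt_eqF p0)// mulr0 mul0r addr0 powR_gt0//.
  by rewrite lt_def x0 andbT -y_eq0.
have ygt0 : 0 < y by rewrite lt_def yn0.
have yE : y `^ p = y * y `^ (p - 1).
  by rewrite -{2}(powRr1 y0) -powRD ?yn0 ?implybT// addrC subrK.
have [x_eq0|xn0] := eqVneq x 0.
  rewrite x_eq0 powR0 ?(gt_eqF p0)// yE.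
  have := mulr_gt0 ygt0 (powR_gt0 (p - 1) ygt0).
  by set z := y `^ _ => ?; nra.
have xgt0 : 0 < x by rewrite lt_def xn0.
(* With [x = y * expR L], dividing by the [p]-th power of [y] reduces the claim to a statement about
   [L] alone. *)
set L := ln x - ln y.
have L0 : L != 0.
  by rewrite subr_eq0; apply: contra xy => /eqP/ln_inj ->.
have xE : x = y * expR L by rewrite expRB !lnK ?posrE// mulrC divfK.
have -> : x `^ p = y `^ p * expR (p * L).
  rewrite /powR (gt_eqF xgt0) (gt_eqF ygt0) -expRD; congr expR.
  by rewrite /L; ring.
rewrite {1}xE yE -subr_gt0.
suff : 0 < expR (p * L) - 1 - p * (expR L - 1).
  move=> h; have := mulr_gt0 (mulr_gt0 ygt0 (powR_gt0 (p - 1) ygt0)) h.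
  by congr (_ < _); ring.
(* The terms linear in [L] cancel between the two summands. Each summand is positive because
   [1 + r < expR r] for [r != 0], taken at [r = (p - 1) * L] and at [r = - L]. *)
rewrite (_ : _ - _ = expR L * (expR ((p - 1) * L) - 1 - (p - 1) * L) +
    (p - 1) * expR L * (expR (- L) - 1 + L)); last first.
  have -> : expR (p * L) = expR L * expR ((p - 1) * L).
    by rewrite -expRD; congr expR; ring.
  have : expR L * expR (- L) = 1 by rewrite -expRD subrr expR0.
  by move: (expR _) (expR _) (expR _) => a b c h; ring: h.
rewrite addr_gt0 ?mulr_gt0 ?expR_gt0 ?subr_gt0//.
- by have := @expR_gt1Dx _ ((p - 1) * L) (mulf_neq0 p10 L0); lra.
- by have := @expR_gt1Dx R (- L); rewrite oppr_eq0 L0 => /(_ isT); lra.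
Qed.

(** * Strict tangent inequality for powers of the Euclidean norm of the plane *)

Section planar.
Context {R : realType} (p : R) (p_gt1 : 1 < p).
Implicit Types (a b c d : R).

Let p_gt0 : 0 < p. Proof. exact: lt_trans p_gt1. Qed.

Let sqn_sqrt a b r :
  (a ^+ 2 + b ^+ 2) `^ r = Num.sqrt (a ^+ 2 + b ^+ 2) `^ (2 * r).
Proof.
rewrite powRrM -powR12_sqrt ?addr_ge0 ?sqr_ge0// -(powRrM _ _ 2) mulVf//.
by rewrite powRr1 ?addr_ge0 ?sqr_ge0.
Qed.

(** Two inequalities are chained: [powR_tangent] for the Euclidean norms [x] of [(a, b)] and [y] of
    [(c, d)], and Cauchy-Schwarz. The first is strict if the norms differ, the second if the norms
    agree but the vectors do not. *)
Lemma planar_tangent a b c d :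
  (c ^+ 2 + d ^+ 2) `^ (p / 2) +
    p * ((c ^+ 2 + d ^+ 2) `^ (p / 2 - 1) * (c * (a - c) + d * (b - d))) <=
  (a ^+ 2 + b ^+ 2) `^ (p / 2) ?= iff ((a == c) && (b == d)).
Proof.
have p20 : p / 2 != 0 by rewrite gt_eqF// divr_gt0.
have [/andP[/eqP-> /eqP->]|neq] := boolP (_ && _).
  by split; rewrite !subrr !mulr0 addr0 !mulr0 addr0 ?eqxx.
suff lt : (c ^+ 2 + d ^+ 2) `^ (p / 2) +
    p * ((c ^+ 2 + d ^+ 2) `^ (p / 2 - 1) * (c * (a - c) + d * (b - d))) <
    (a ^+ 2 + b ^+ 2) `^ (p / 2).
  by split; [exact: ltW | rewrite lt_eqF].
have [cd0|cdn0] := eqVneq (c ^+ 2 + d ^+ 2) 0.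
  have /andP[/eqP c0 /eqP d0] : (c == 0) && (d == 0).
    by move/eqP: cd0; rewrite paddr_eq0 ?sqr_ge0// !sqrf_eq0.
  move: neq; rewrite cd0 c0 d0 powR0// !(mul0r, addr0, mulr0) => neq.
  rewrite powR_gt0// lt_def addr_ge0 ?sqr_ge0// andbT.
  by rewrite paddr_eq0 ?sqr_ge0// !sqrf_eq0.
rewrite !sqn_sqrt.
have -> : 2 * (p / 2) = p by field.
have -> : 2 * (p / 2 - 1) = p - 1 - 1 by field.
set y := Num.sqrt (c ^+ 2 + d ^+ 2); set x := Num.sqrt (a ^+ 2 + b ^+ 2).
have x0 : 0 <= x by exact: sqrtr_ge0.
have y0 : 0 < y by rewrite sqrtr_gt0 lt_def cdn0 addr_ge0 ?sqr_ge0.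
have x2 : x ^+ 2 = a ^+ 2 + b ^+ 2 by rewrite sqr_sqrtr ?addr_ge0 ?sqr_ge0.
have y2 : y ^+ 2 = c ^+ 2 + d ^+ 2 by rewrite sqr_sqrtr ?addr_ge0 ?sqr_ge0.
have [T Teq] := powR_tangent p_gt1 x0 (ltW y0).
have yE : y `^ (p - 1) = y * y `^ (p - 1 - 1).
  rewrite -{2}(powRr1 (ltW y0)) -powRD ?(gt_eqF y0) ?implybT//.
  by rewrite [1 + _]addrC subrK.
have z0 := powR_gt0 (p - 1 - 1) y0.
rewrite yE in T Teq; move: T Teq z0; set z := y `^ (p - 1 - 1) => T Teq z0.
(* Cauchy-Schwarz, from Lagrange's identity: the squares of the two sides differ by
   [(a * d - b * c) ^+ 2]. *)
have cs : a * c + b * d <= x * y.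
  rewrite leNgt; apply/negP => lt_cs.
  have : (x * y) ^+ 2 < (a * c + b * d) ^+ 2.
    by rewrite ltr_pXn2r ?nnegrE ?(le_trans _ (ltW lt_cs)) ?mulr_ge0 ?(ltW y0).
  rewrite exprMn x2 y2; have := sqr_ge0 (a * d - b * c).
  by rewrite -subr_ge0 -subr_gt0; nra.
have pz0 : 0 < p * z by rewrite mulr_gt0.
have -> : c * (a - c) + d * (b - d) = (a * c + b * d) - y ^+ 2.
  by rewrite y2; ring.
have [xy|xy] := eqVneq x y; last first.
  move: T; rewrite le_eqVlt Teq (negPf xy) /=; apply: le_lt_trans.
  rewrite lerD2l -!mulrA ler_pM2l// mulrCA ler_pM2l//.
  by move: cs; lra.
have {}cs : a * c + b * d < y ^+ 2.
  move: cs; rewrite xy -expr2 le_eqVlt => /predU1P[cs|//].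
  have : (a - c) ^+ 2 + (b - d) ^+ 2 = 0.
    transitivity (x ^+ 2 - (a * c + b * d) *+ 2 + y ^+ 2).
      by rewrite x2 y2; ring.
    by rewrite cs xy; ring.
  move/eqP; rewrite paddr_eq0 ?sqr_ge0// !sqrf_eq0 !subr_eq0.
  by rewrite (negPf neq).
by rewrite xy -[ltRHS]addr0 ltrD2l mulrA pmulr_rlt0// subr_lt0.
Qed.

End planar.

(** * Isometries, continuity and derivatives in normed spaces; maps preserving convex
    combinations *)

Section normed_module.
Context {R : realType} {V : normedModType R}.
Implicit Types (u v w x y : V) (s : R).

Lemma normr_invZ v w s : 0 < s -> `|v| = s * `|w| -> `|s^-1 *: v| = `|w|.
Proof.
by move=> s0 vs; rewrite normrZ gtr0_norm ?invr_gt0// vs mulKf ?gt_eqF.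
Qed.

(** The first hypothesis is strict convexity: a point of a segment is determined by its distances to
    the two ends. As [f] keeps these distances, the hypothesis applies to [u = f z - f y] and
    [w = f x - f y]. *)
Lemma isometry_convex (f : V -> V) x y s :
  (forall u w, `|u| = s * `|w| -> `|w - u| = (1 - s) * `|w| -> u = s *: w) ->
  (forall x y, `|f x - f y| = `|x - y|) -> 0 < s < 1 ->
  f (s *: x + (1 - s) *: y) = s *: f x + (1 - s) *: f y.
Proof.
move=> convex iso s01; have /andP[s0 s1] := s01; set z := s *: x + _.
have zy : z - y = s *: (x - y).
  by rewrite /z scalerBl scale1r scalerBr addrA addrAC addrK.
have xz : x - z = (1 - s) *: (x - y).
  by rewrite -[x - z](subrKA y) -[y - z]opprB zy scalerBl scale1r.
suff : f z - f y = s *: (f x - f y).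
  move/eqP; rewrite subr_eq => /eqP ->.
  by rewrite scalerBl scale1r scalerBr -addrA [- _ + _]addrC.
apply: convex.
  by rewrite !iso zy normrZ gtr0_norm.
by rewrite opprB subrKA !iso xz normrZ gtr0_norm// subr_gt0.
Qed.

Lemma nonexpansive_continuous (f : V -> R) :
  (forall u v, `|f u - f v| <= `|u - v|) -> continuous f.
Proof.
move=> lip v; apply/cvgrPdist_le => e e0; near=> u.
by apply: (le_trans (lip _ _)); near: u; exact: cvgr_dist_le.
Unshelve. all: by end_near. Qed.

Lemma continuous_lincomb3 (f g h : V -> R) (a b c : R) :
  continuous f -> continuous g -> continuous h ->
  continuous (fun v => a * f v + b * g v + c * h v).
Proof.
move=> cf cg ch v; apply: cvgD; [apply: cvgD|]; apply: cvgMl_tmp;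
  [exact: cf | exact: cg | exact: ch].
Qed.

Lemma is_derive_scale (f : R -> R) (v : V) (t df : R) :
  is_derive t 1 f df -> is_derive t 1 (fun s => f s *: v) (df *: v).
Proof.
move=> [fd <-].
have cf : h^-1 *: (f (h *: 1 + t) *: v - f t *: v) @[h --> 0^'] -->
    'D_1 f t *: v.
  under eq_fun do rewrite -scalerBl scalerA.
  by apply: cvgZr_tmp; exact: fd.
apply: DeriveDef; first by apply/cvg_ex; eexists; exact: cf.
exact: cvg_lim cf.
Qed.

End normed_module.

(** Taking [y = 0] gives homogeneity for factors in [(0, 1)], hence for the factor 2. The midpoint
    of [2 *: x] and [2 *: y] then gives additivity, which yields negatives; factors above 1 are
    reached through their inverses. *)
Lemma convex_affine (R : realFieldType) (V W : lmodType R) (f : V -> W) :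
  (forall x y s, 0 < s < 1 ->
    f (s *: x + (1 - s) *: y) = s *: f x + (1 - s) *: f y) ->
  linear (fun x => f x - f 0).
Proof.
move=> fC.
have fZ1 s x : 0 < s < 1 -> f (s *: x) - f 0 = s *: (f x - f 0).
  move=> s01; have := fC x 0 s s01; rewrite scaler0 addr0 => ->.
  by rewrite scalerBl scale1r scalerBr addrA addrAC addrK addrC.
have h01 : 0 < (2^-1 : R) < 1.
  by apply/andP; split; [rewrite invr_gt0 | rewrite invf_lt1 ?ltr1n].
have fE2 x : f (2 *: x) - f 0 = 2 *: (f x - f 0).
  have := fZ1 _ (2 *: x) h01; rewrite scalerA mulVf ?pnatr_eq0// scale1r => ->.
  by rewrite scalerA mulfV ?pnatr_eq0// scale1r.
have fD x y : f (x + y) - f 0 = (f x - f 0) + (f y - f 0).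
  have := fC (2 *: x) (2 *: y) _ h01.
  have -> : 1 - 2^-1 = 2^-1 :> R by field.
  rewrite !scalerA mulVf ?pnatr_eq0// !scale1r => ->.
  apply: (@scalerI _ _ (2 : R)); rewrite ?pnatr_eq0//.
  rewrite [RHS]scalerDr -!fE2 scalerBr scalerDr !scalerA mulfV ?pnatr_eq0//.
  rewrite !scale1r.
  by rewrite [2 *: f 0]scaler_nat mulr2n opprD addrACA.
have fN x : f (- x) - f 0 = - (f x - f 0).
  by apply/eqP; rewrite -addr_eq0 -fD addNr subrr.
have fZ0 s x : 0 <= s -> f (s *: x) - f 0 = s *: (f x - f 0).
  rewrite le_eqVlt => /predU1P[<-|s0]; first by rewrite !scale0r subrr.
  have [s1|s1|->] := ltgtP s 1; last by rewrite !scale1r.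
    by rewrite fZ1// s0.
  have := fZ1 s^-1 (s *: x); rewrite invr_gt0 s0 invf_lt1// s1 => /(_ isT).
  by rewrite scalerK ?gt_eqF// => ->; rewrite scalerA mulfV ?gt_eqF// scale1r.
move=> a x y; rewrite fD; congr (_ + _).
have [a0|/ltW a0] := leP 0 a; first exact: fZ0.
by rewrite -[a]opprK scaleNr fN fZ0 ?oppr_ge0// -scaleNr.
Qed.

(** * Strict convexity of the space and continuity of its coordinates *)

Section ell3.
Context {R : realType} {p : R} {p_gt1 : 1 < p}.
Local Notation X := (ell3_2p p_gt1).
Implicit Types (u v w x y : X) (a s t lambda : R).

Lemma ell3_normE v : `|v| = norm2p p v. Proof. by []. Qed.

Lemma ell3D u v i : (u + v) 0 i = u 0 i + v 0 i. Proof. exact: mxE. Qed.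
Lemma ell3N v i : (- v) 0 i = - v 0 i. Proof. exact: mxE. Qed.
Lemma ell3Z a v i : (a *: v) 0 i = a * v 0 i. Proof. exact: mxE. Qed.
Lemma ell3_0 i : (0 : X) 0 i = 0. Proof. exact: mxE. Qed.
Lemma vec3_0 a b c : vec3 p_gt1 a b c 0 0 = a. Proof. exact: mxE. Qed.
Lemma vec3_1 a b c : vec3 p_gt1 a b c 0 1 = b. Proof. exact: mxE. Qed.
Lemma vec3_2 a b c : vec3 p_gt1 a b c 0 2 = c. Proof. exact: mxE. Qed.
Definition ell3E := (ell3D, ell3N, ell3Z, ell3_0, vec3_0, vec3_1, vec3_2).

Lemma ell3P u v :
  u 0 0 = v 0 0 -> u 0 1 = v 0 1 -> u 0 2 = v 0 2 -> u = v.
Proof.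
move=> e0 e1 e2; apply/rowP => -[[|[|[|//]]] i].
- by rewrite (_ : Ordinal i = 0)//; exact: val_inj.
- by rewrite (_ : Ordinal i = 1)//; exact: val_inj.
- by rewrite (_ : Ordinal i = 2)//; exact: val_inj.
Qed.

Let p_gt0 : 0 < p. Proof. exact: lt_trans p_gt1. Qed.

(* The axis is written as a plane whose second coordinate is [0], so that
   [planar_tangent] applies to both parts. *)
Definition pow_norm v : R :=
  (v 0 0 ^+ 2 + v 0 1 ^+ 2) `^ (p / 2) + (v 0 2 ^+ 2 + 0 ^+ 2) `^ (p / 2).

Lemma pow_normE v : pow_norm v = `|v| `^ p.
Proof.
rewrite ell3_normE /norm2p -powRrM mulVf ?gt_eqF// powRr1 ?addr_ge0 ?powR_ge0//.
rewrite /pow_norm expr0n/= addr0.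
have -> : v 0 2 ^+ 2 = `|v 0 2| `^ 2.
  by rewrite (powR_mulrn 2)// real_normK ?num_real.
by rewrite -powRrM; congr (_ + _ `^ _); field.
Qed.

(** Up to the factor [p], the differential of [pow_norm] at [v] applied to [w]. Where a base is 0
    the value of its power is harmless, since the factor next to it is 0 too. *)
Definition dual_pairing v w : R :=
  (v 0 0 ^+ 2 + v 0 1 ^+ 2) `^ (p / 2 - 1) * (v 0 0 * w 0 0 + v 0 1 * w 0 1) +
  (v 0 2 ^+ 2 + 0 ^+ 2) `^ (p / 2 - 1) * (v 0 2 * w 0 2).

Lemma pow_norm_tangent v u :
  pow_norm v + p * dual_pairing v (u - v) <= pow_norm u ?= iff (u == v).
Proof.
have := leifD (planar_tangent p_gt1 (u 0 0) (u 0 1) (v 0 0) (v 0 1))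
  (planar_tangent p_gt1 (u 0 2) 0 (v 0 2) 0).
rewrite eqxx andbT subrr mulr0 addr0 => H.
rewrite (_ : u == v = (u 0 0 == v 0 0) && (u 0 1 == v 0 1) && (u 0 2 == v 0 2)).
  by congr (_ <= _ ?= iff _): H; rewrite /pow_norm /dual_pairing !ell3E; ring.
apply/eqP/andP => [->|[/andP[/eqP ? /eqP ?] /eqP ?]]; last exact: ell3P.
by rewrite !eqxx.
Qed.

Lemma dual_pairingZ v a w : dual_pairing v (a *: w) = a * dual_pairing v w.
Proof. by rewrite /dual_pairing !ell3E; ring. Qed.

(** On a sphere the two values of [pow_norm] cancel in [pow_norm_tangent], so [v] is the only
    maximizer of its own functional [dual_pairing v]. *)
Lemma pow_norm_eq_tangent v u : `|u| = `|v| ->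
  dual_pairing v (u - v) <= 0 ?= iff (u == v).
Proof.
move=> uv; have [] := pow_norm_tangent v u.
rewrite (pow_normE u) uv -pow_normE gerDl (pmulr_rle0 _ p_gt0).
rewrite -subr_eq0 addrAC subrr add0r mulf_eq0 (gt_eqF p_gt0)/=.
by split.
Qed.

(** The vectors [s^-1 *: u] and [(1 - s)^-1 *: (w - u)] have the norm of [w], and their average with
    weights [s] and [1 - s] is [w]. So two nonpositive pairings have weighted sum 0; both vanish,
    and the equality case applies. *)
Lemma ell3_strict_convex u w s : 0 < s < 1 ->
  `|u| = s * `|w| -> `|w - u| = (1 - s) * `|w| -> u = s *: w.
Proof.
move=> /andP[s0 s1] us uw; have s10 : 0 < 1 - s by rewrite subr_gt0.
have [le1 eq1] := pow_norm_eq_tangent (normr_invZ s0 us).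
have [le2 _] := pow_norm_eq_tangent (normr_invZ s10 uw).
suff /eqP : dual_pairing w (s^-1 *: u - w) = 0.
  by rewrite eq1 => /eqP <-; rewrite scalerA mulfV ?gt_eqF// scale1r.
apply: le_anti; rewrite le1/=.
rewrite -(pmulr_rge0 _ s0) -[leRHS]opprK oppr_ge0.
rewrite (_ : - _ = (1 - s) * dual_pairing w ((1 - s)^-1 *: (w - u) - w)).
  by rewrite pmulr_rle0.
rewrite -mulrN -mulN1r -!dual_pairingZ; congr dual_pairing.
rewrite scaleN1r scalerN scalerBr [in RHS]scalerBr !scalerA.
rewrite !mulfV ?gt_eqF// !scale1r.
by rewrite scalerBl scale1r !opprB [RHS]addrC subrKA.
Qed.

(** Makes the coordinates nonexpansive, hence continuous for the topology of this norm. *)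
Lemma le_coord_ell3 v (i : 'I_3) : `|v 0 i| <= `|v|.
Proof.
have powE r : `|r| `^ p = (r ^+ 2) `^ (p / 2).
  have -> : r ^+ 2 = `|r| `^ 2 by rewrite (powR_mulrn 2)// real_normK ?num_real.
  by rewrite -powRrM mulrC divfK.
suff : `|v 0 i| `^ p <= `|v| `^ p.
  rewrite !leNgt; apply: contra => lt_v.
  by rewrite gt0_ltr_powR ?nnegrE.
rewrite -pow_normE powE /pow_norm.
have le_pow a b : 0 <= a -> a <= b -> a `^ (p / 2) <= b `^ (p / 2).
  move=> a0 ab; apply: ge0_ler_powR; rewrite ?nnegrE ?(le_trans a0 ab)//.
  by rewrite divr_ge0// ltW.
have [->|->|->] : [\/ i = 0, i = 1 | i = 2].
  by case: i => -[|[|[|//]]] ?;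
    [apply: Or31|apply: Or32|apply: Or33]; exact: val_inj.
- by rewrite ler_wpDr ?powR_ge0// le_pow ?sqr_ge0// lerDl sqr_ge0.
- by rewrite ler_wpDr ?powR_ge0// le_pow ?sqr_ge0// lerDr sqr_ge0.
- by rewrite ler_wpDl ?powR_ge0// le_pow ?sqr_ge0// lerDl sqr_ge0.
Qed.

Lemma ell3_coord_continuous (i : 'I_3) : continuous (fun v : X => v 0 i : R).
Proof.
apply: nonexpansive_continuous => u v; rewrite -ell3N -ell3D.
exact: le_coord_ell3.
Qed.

Lemma dual_pairing_continuous v : continuous (dual_pairing v).
Proof.
rewrite (_ : dual_pairing v = fun w =>
  ((v 0 0 ^+ 2 + v 0 1 ^+ 2) `^ (p / 2 - 1) * v 0 0) * w 0 0 +
  ((v 0 0 ^+ 2 + v 0 1 ^+ 2) `^ (p / 2 - 1) * v 0 1) * w 0 1 +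
  ((v 0 2 ^+ 2 + 0 ^+ 2) `^ (p / 2 - 1) * v 0 2) * w 0 2).
  by apply: continuous_lincomb3; exact: ell3_coord_continuous.
by apply/funext => w; rewrite /dual_pairing; ring.
Qed.

(** * Difference quotients of rigid motions at time 0 *)

Definition quotient_at0 (f : R -> X) (h : R) : X := h^-1 *: (f h - f 0).

Lemma cvg_quotient_at0 (f : R -> X) w : derivable f 0 1 -> w = derive1 f 0 ->
  quotient_at0 f h @[h --> 0^'] --> w.
Proof.
have qE : quotient_at0 f = fun h =>
    h^-1 *: ((f \o shift 0) (h *: (1 : R)) - f 0).
  by apply/funext => h; rewrite /quotient_at0 /= addr0 [_%:A]mulr1.
by rewrite derive1E /derivable /derive -qE => + ->.
Qed.

Lemma near0_itv : \forall h \near (0 : R)^', h \in `[-1, 1].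
Proof.
near=> h; rewrite in_itv/= -ler_norml; near: h.
exact: dnbhs0_le.
Unshelve. all: by end_near. Qed.

Lemma inf_rigid_motion_convex (eta : X -> X) x y s : inf_rigid_motions X eta ->
  0 < s < 1 -> eta (s *: x + (1 - s) *: y) = s *: eta x + (1 - s) *: eta y.
Proof.
move=> [alpha [_ al0 iso] D] s01.
have cvgq z : quotient_at0 (alpha z) h @[h --> 0^'] --> eta z.
  by have [] := D z; exact: cvg_quotient_at0.
have := cvgq (s *: x + (1 - s) *: y).
have : s *: quotient_at0 (alpha x) h + (1 - s) *: quotient_at0 (alpha y) h
    @[h --> 0^'] --> s *: eta x + (1 - s) *: eta y.
  by apply: cvgD; apply: cvgZl_tmp.
(* It suffices that the two quotients coincide for [h] near 0, where [alpha^~ h] is an isometry. *)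
move=> h1 h2; apply: (cvg_unique _ h2 _) => //.
apply: cvg_trans h1; apply: near_eq_cvg; near=> h.
have hI : h \in `[-1, 1] by near: h; exact: near0_itv.
have iso_h u v : `|alpha u h - alpha v h| = `|u - v| by exact: iso.
have convex u w := @ell3_strict_convex u w s s01.
rewrite /quotient_at0 !al0.
rewrite (isometry_convex (f := alpha^~ h) x y convex iso_h s01).
rewrite !scalerA ![_ * h^-1]mulrC -!scalerA -scalerDr; congr (_ *: _).
by rewrite !scalerBr opprD addrACA.
Unshelve. all: by end_near. Qed.

Lemma inf_rigid_motion_orth (eta : X -> X) x y : inf_rigid_motions X eta ->
  dual_pairing (x - y) (eta x - eta y) = 0.
Proof.
move=> [alpha [_ al0 iso] D].
have cvgq z : quotient_at0 (alpha z) h @[h --> 0^'] --> eta z.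
  by have [] := D z; exact: cvg_quotient_at0.
pose q h := dual_pairing (x - y)
  (quotient_at0 (alpha x) h - quotient_at0 (alpha y) h).
have cq : q h @[h --> 0^'] --> dual_pairing (x - y) (eta x - eta y).
  apply: (@continuous_cvg _ _ _ _ _ _ (dual_pairing (x - y))).
    exact: dual_pairing_continuous.
  by apply: cvgB; apply: cvgq.
(* Here [h * q h] is the pairing of [x - y] with [(alpha x h - alpha y h) - (x - y)], a difference
   of two vectors of equal norm. *)
have hq h : h != 0 -> h \in `[-1, 1] -> h * q h <= 0.
  move=> h0 hI; have [+ _] := pow_norm_eq_tangent (iso x y h hI).
  congr (_ <= _); rewrite /q /quotient_at0 !al0 -scalerBr dual_pairingZ.
  rewrite mulVKf//.
  by congr dual_pairing; rewrite !opprD addrACA.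
(* Dividing by [h] makes [q h] nonpositive on the right of 0 and nonnegative on the left, and both
   one-sided limits are the same number. *)
apply: le_anti; apply/andP; split.
  have cr := cvg_dnbhs_at_right cq; rewrite -(cvg_lim _ cr)//.
  apply: limr_le; first by apply/cvg_ex; eexists; exact: cr.
  near=> h; have h0 : 0 < h by near: h; exact: nbhs_right_gt.
  rewrite -(pmulr_rle0 _ h0) hq ?gt_eqF// in_itv/= (le_trans _ (ltW h0))//=.
  by near: h; exact: nbhs_right_le.
have cl := cvg_dnbhs_at_left cq; rewrite -(cvg_lim _ cl)//.
apply: limr_ge; first by apply/cvg_ex; eexists; exact: cl.
near=> h; have h0 : h < 0 by near: h; exact: nbhs_left_lt.
rewrite -(nmulr_rle0 _ h0) hq ?lt_eqF// in_itv/= (le_trans (ltW h0))// andbT.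
by near: h; exact: nbhs_left_ge.
Unshelve. all: by end_near. Qed.

(** * The linear part when [p != 2] *)

Definition rot90 x : X := vec3 p_gt1 (- x 0 1) (x 0 0) 0.

Lemma inf_rigid_motion_rot (eta : X -> X) : p != 2 -> inf_rigid_motions X eta ->
  exists lambda (c : X), eta = fun x => lambda *: rot90 x + c.
Proof.
move=> p2 eta_rm.
have lin := convex_affine (fun x y s => inf_rigid_motion_convex x y eta_rm).
set z := fun x => eta x - eta 0 in lin.
have orth x : dual_pairing x (z x) = 0.
  by have := inf_rigid_motion_orth x 0 eta_rm; rewrite subr0.
have z0 : z 0 = 0 by rewrite /z subrr.
have zE a b d : z (vec3 _ a b d) =
    a *: z (vec3 _ 1 0 0) + (b *: z (vec3 _ 0 1 0) + d *: z (vec3 _ 0 0 1)).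
  rewrite -[d *: z _]addr0 -z0 -!lin; congr z.
  by apply: ell3P; rewrite !ell3E; ring.
have {}orth a b d : dual_pairing (vec3 p_gt1 a b d)
    (a *: z (vec3 _ 1 0 0) +
      (b *: z (vec3 _ 0 1 0) + d *: z (vec3 _ 0 0 1))) = 0.
  by rewrite -zE.
have etaE x : eta x = z x + eta 0 by rewrite /z subrK.
have xE x : x = vec3 _ (x 0 0) (x 0 1) (x 0 2) by apply: ell3P; rewrite ell3E.
move: zE orth; rewrite /dual_pairing.
set e0 := z (vec3 _ 1 0 0); set e1 := z (vec3 _ 0 1 0).
set e2 := z (vec3 _ 0 0 1).
(* The columns of the linear part become unknowns, subject to the equations [orth]. *)
clearbody e0 e1 e2 => zE orth.
have p2n0 : p / 2 - 1 != 0.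
  apply: contra p2 => /eqP h; apply/eqP.
  by rewrite -[p](divfK (x := 2)) ?pnatr_eq0// (subr0_eq h) mul1r.
(* A power of 4 is 1 only for exponent 0, so this is where [p != 2] enters. *)
have pow4 : 1 - (2 ^+ 2 : R) `^ (p / 2 - 1) != 0.
  rewrite subr_eq0 eq_sym powR_eq1 (negPf p2n0) orbF negb_or -leNgt.
  by rewrite sqr_ge0 andbT -natrX (eqr_nat _ 4 1).
have pow2 : (1 + 1 : R) `^ (p / 2 - 1) != 0 by rewrite gt_eqF// powR_gt0.
(* The basis vectors kill the diagonal, and sums of two of them give antisymmetry. The vectors
   [(1, 0, 2)] and [(0, 1, 2)] weigh plane and axis differently, which kills the mixed entries
   through [1 - k4 != 0]. *)
have o1 := orth 1 0 0; have o2 := orth 0 1 0; have o3 := orth 0 0 1.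
have o4 := orth 1 1 0; have o5 := orth 1 0 1; have o6 := orth 0 1 1.
have o7 := orth 1 0 2; have o8 := orth 0 1 2.
rewrite !ell3E in o1 o2 o3 o4 o5 o6 o7 o8.
rewrite !(expr1n, expr0n)/= !(mul0r, mul1r, mulr0, addr0, add0r, powR1)
  in o1 o2 o3 o4 o5 o6 o7 o8.
move: (_ `^ _) pow2 o4 => k2 pow2 /eqP.
rewrite mulf_eq0 (negPf pow2)/= => /eqP o4.
move: (_ `^ _) pow4 o7 o8 => k4 pow4.
rewrite o1 o2 o3 !(mulr0, add0r, addr0) in o4 o5 o6 *.
have e02 : e0 0 2 = - e2 0 0 by apply/eqP; rewrite -addr_eq0 addrC o5.
have e12 : e1 0 2 = - e2 0 1 by apply/eqP; rewrite -addr_eq0 addrC o6.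
have e10 : e1 0 0 = - e0 0 1 by apply/eqP; rewrite -addr_eq0 o4.
rewrite e02 e12 => o7 o8.
have e20 : e2 0 0 = 0.
  have /eqP : 2 * (1 - k4) * e2 0 0 = 0 by rewrite -o7; ring.
  by rewrite !mulf_eq0 pnatr_eq0 (negPf pow4) => /eqP.
have e21 : e2 0 1 = 0.
  have /eqP : 2 * (1 - k4) * e2 0 1 = 0 by rewrite -o8; ring.
  by rewrite !mulf_eq0 pnatr_eq0 (negPf pow4) => /eqP.
rewrite e20 oppr0 in e02; rewrite e21 oppr0 in e12.
exists (e0 0 1), (eta 0); apply/funext => x; rewrite etaE; congr (_ + _).
rewrite [in LHS](xE x) zE.
by apply: ell3P; rewrite !ell3E ?(o1, o2, o3, e10, e20, e21, e02, e12); ring.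
Qed.

(** * Realization by rotations about the axis combined with translations *)

Let plane x : X := vec3 _ (x 0 0) (x 0 1) 0.
Let axis x : X := vec3 _ 0 0 (x 0 2).

(** Rotation by the angle [lambda * t] about the third axis, then translation by [t *: c]; the
    direction of [c] is arbitrary. *)
Definition screw lambda (c : X) x t : X :=
  cos (lambda * t) *: plane x + sin (lambda * t) *: rot90 x + t *: c + axis x.

Lemma screw_isometry lambda (c : X) x y t :
  `|screw lambda c x t - screw lambda c y t| = `|x - y|.
Proof.
rewrite !ell3_normE /norm2p !ell3E.
have := cos2Dsin2 (lambda * t); move: (cos _) (sin _) => C S CS.
set A := (X in X `^ (p / 2) + _); set B := (X in _ = (X `^ (p / 2) + _) `^ _).
have -> : A = B.
  (* Multiplying [B] by [cos^2 + sin^2] makes the equality a polynomial identity in [C] and [S]. *)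
  by rewrite -[B]mul1r -CS /A /B; ring.
by congr ((_ + `|_| `^ p) `^ _); ring.
Qed.

Lemma is_derive_screw lambda (c : X) x t : is_derive t 1 (screw lambda c x)
  ((- sin (lambda * t) * lambda) *: plane x +
   (cos (lambda * t) * lambda) *: rot90 x + c).
Proof.
have dl : is_derive t 1 (fun t => lambda * t) lambda.
  by apply: is_derive_eq; exact: mulr1.
have dcos := is_derive1_comp (is_derive_cos (lambda * t)) dl.
have dsin := is_derive1_comp (is_derive_sin (lambda * t)) dl.
have -> : (- sin (lambda * t) * lambda) *: plane x +
    (cos (lambda * t) * lambda) *: rot90 x + c =
    (- sin (lambda * t) * lambda) *: plane x +
    (cos (lambda * t) * lambda) *: rot90 x + 1 *: c + 0.
  by rewrite scale1r addr0.
apply: is_deriveD; apply: is_deriveD; first apply: is_deriveD.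
- exact: (is_derive_scale _ dcos).
- exact: (is_derive_scale _ dsin).
- exact: is_derive_scale.
Qed.

Lemma rot_inf_rigid_motion lambda (c : X) :
  inf_rigid_motions X (fun x => lambda *: rot90 x + c).
Proof.
exists (screw lambda c); last first.
  move=> x; have D := is_derive_screw lambda c x 0.
  split; first exact: ex_derive.
  rewrite derive1E derive_val mulr0 sin0 cos0 oppr0.
  by rewrite mul0r mul1r scale0r add0r.
split.
- move=> x; apply: derivable_within_continuous => t _; apply: ex_derive.
  exact: is_derive_screw.
- move=> x; rewrite /screw mulr0 sin0 cos0 !scale0r !addr0 scale1r.
  by apply: ell3P; rewrite !ell3E; ring.
- by move=> x y t _; exact: screw_isometry.
Qed.

Lemma inf_rigid_motionsE : p != 2 ->
  inf_rigid_motions X =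
  [set eta | exists lambda (c : X), eta = fun x => lambda *: rot90 x + c].
Proof.
move=> p2; apply/seteqP; split=> [eta /= /(inf_rigid_motion_rot p2)//|eta /=].
by move=> [lambda [c ->]]; exact: rot_inf_rigid_motion.
Qed.

(** * A basis of four vector fields: [rot90] and three constants *)

Lemma has_dim_rot :
  has_dim [set eta : X -> X |
    exists lambda (c : X), eta = fun x => lambda *: rot90 x + c] 4.
Proof.
pose e (i : 'I_4) : X -> X :=
  [:: rot90; cst (vec3 _ 1 0 0); cst (vec3 _ 0 1 0); cst (vec3 _ 0 0 1)]`_i.
exists e.
have sumE (a : 'I_4 -> R) : \sum_(i < 4) a i *: e i =
    fun x => a 0 *: rot90 x + vec3 _ (a 1) (a 2) (a 3).
  apply/funext => x; rewrite fct_sumE !big_ord_recl big_ord0.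
  rewrite (_ : lift _ (lift _ (lift _ _)) = 3); last exact: val_inj.
  rewrite (_ : lift _ (lift _ _) = 2); last exact: val_inj.
  rewrite (_ : lift _ _ = 1); last exact: val_inj.
  rewrite (_ : ord0 = 0); last exact: val_inj.
  rewrite !fctE /e /=.
  by apply: ell3P; rewrite !ell3E; ring.
split=> [a|].
  rewrite sumE => /funeqP a0.
  (* Evaluation at 0 isolates the three translation coefficients; the second coordinate at
     [(1, 0, 0)] then gives the coefficient of [rot90]. *)
  have coord x i := congr1 (fun v : X => v 0 i) (a0 x).
  have a1 := coord 0 0; have a2 := coord 0 1; have a3 := coord 0 2.
  have a4 := coord (vec3 _ 1 0 0) 1.
  rewrite !ell3E ?(oppr0, mulr0, mulr1, add0r) in a1 a2 a3 a4.
  rewrite a2 addr0 in a4 => -[[|[|[|[|//]]]] i].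
  - by rewrite -[RHS]a4; congr a; exact: val_inj.
  - by rewrite -[RHS]a1; congr a; exact: val_inj.
  - by rewrite -[RHS]a2; congr a; exact: val_inj.
  - by rewrite -[RHS]a3; congr a; exact: val_inj.
apply/seteqP; split=> [_ [lambda [c ->]]|_ [a ->]] /=.
  exists (fun i => [:: lambda; c 0 0; c 0 1; c 0 2]`_i); rewrite sumE.
  by apply/funext => x; congr (_ + _); apply: ell3P; rewrite !ell3E.
by rewrite sumE; exists (a 0), (vec3 _ (a 1) (a 2) (a 3)).
Qed.

End ell3.

Theorem theorem6p9 (R : realType) (p : R) (p_gt1 : 1 < p) (p_neq2 : p != 2) :
  (forall eta : ell3_2p p_gt1 -> ell3_2p p_gt1, affine_map eta ->
     (inf_rigid_motions (ell3_2p p_gt1) eta <->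
      exists (lambda : R) (c : ell3_2p p_gt1), forall x1 x2 x3 : R,
        eta (vec3 p_gt1 x1 x2 x3) = lambda *: vec3 p_gt1 (- x2) x1 0 + c)) /\
  has_dim (inf_rigid_motions (ell3_2p p_gt1)) 4.
Proof.
rewrite inf_rigid_motionsE//; split; last exact: has_dim_rot.
move=> eta _; split=> [[lambda [c ->]]|[lambda [c etaE]]]; exists lambda, c.
  by move=> x1 x2 x3; rewrite /rot90 !ell3E.
(* The right side of [etaE] does not determine [x3], so [x 0 2] is supplied by hand. *)
apply/funext => x; rewrite /rot90 -(etaE _ _ (x 0 2)); congr eta.
by apply: ell3P; rewrite ell3E.
Qed.
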